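(* Let $G$ be a finite group and let $S \subseteq G$ be a symmetric subset (i.e. $S = S^{-1}$). Let $n = |G|$ and $d = |S|$, and let $\epsilon \ge 0$. If the Cayley graph $\mathrm{Cay}(G,S)$ is $\epsilon$-uniform, then it is an $(n,d,\lambda)$-graph with $\lambda \le 8\epsilon d$.
   Context: The Cayley graph $\mathrm{Cay}(G,S)$ has vertex set $G$ and edge set $\{(sg,g) : g \in G, s \in S\}$; since $S$ is symmetric it is viewed as an undirected $d$-regular graph on $n$ vertices. For a graph $\Gamma$ on vertex set $V$ and $S',T \subseteq V$, $e(S',T)$ denotes the number of pairs $(s,t) \in S' \times T$ with $s,t$ adjacent, i.e. $e(S',T)=\sum_{s\in S',t\in T} a_{st}$ where $A(\Gamma) = (a_{st})$ is the adjacency matrix ($a_{st}=1$ if $s,t$ are adjacent and $0$ otherwise). An $n$-vertex $d$-regular graph $\Gamma=(V,E)$ is $\epsilon$-uniform if $\left|e(S',T) - \frac{d}{n}|S'||T|\right| \le \epsilon d n$ for all $S',T \subseteq V$. An $n$-vertex $d$-regular graph $\Gamma$ is an $(n,d,\lambda)$-graph if all eigenvalues of $A(\Gamma)$ except the largest are at most $\lambda$ in absolute value; equivalently, $\|A(\Gamma) - \frac{d}{n}J\| \le \lambda$, where $J$ is the $n\times n$ all-ones matrix and $\|\cdot\|$ is the spectral (operator $\ell^2\to\ell^2$) norm. *)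

(* Defs.v *)
From HB Require Import structures.
From mathcomp Require Import all_boot all_order all_algebra all_fingroup.
From mathcomp Require Import reals.

Set Implicit Arguments.
Unset Strict Implicit.
Unset Printing Implicit Defensive.

Import Order.TTheory GRing.Theory Num.Theory.
Local Open Scope ring_scope.

(* A graph on V is a symmetric adjacency relation e : rel V; loops are allowed,
   since a Cayley graph has one at every vertex when the identity is in S. *)
Definition cay (gT : finGroupType) (S : {set gT}) : rel gT :=
  fun x y => [exists s in S, x == (s * y)%g].

Definition regular_graph (V : finType) (e : rel V) (d : nat) : Prop :=
  symmetric e /\ forall v : V, #|[set w | e v w]| = d.

(* Ordered pairs: an edge inside A :&: B is counted in both directions. *)
Definition edge_count (V : finType) (e : rel V) (A B : {set V}) : nat :=
  #|[set p in setX A B | e p.1 p.2]|.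

(* d stands for the degree; regularity itself is not part of this predicate. *)
Definition uniform_graph (R : realType) (V : finType) (e : rel V) (d : nat)
    (eps : R) : Prop :=
  forall A B : {set V},
    `|(edge_count e A B)%:R - d%:R / #|V|%:R * #|A|%:R * #|B|%:R|
      <= eps * d%:R * #|V|%:R.

Definition adjacency (R : realType) (V : finType) (e : rel V) : 'M[R]_#|V| :=
  \matrix_(i, j) (e (enum_val i) (enum_val j))%:R.

(* s lists the eigenvalues of M with multiplicity, largest first; such an s is
   unique, and exists exactly when all eigenvalues of M are in R. *)
Definition eigenvalue_seq (R : realType) (m : nat) (M : 'M[R]_m) (s : seq R)
    : Prop :=
  char_poly M = \prod_(x <- s) ('X - x%:P) /\ sorted >=%R s.

(* Only one copy of the largest eigenvalue is dropped, so that a disconnected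
   d-regular graph has lambda >= d. *)
Definition ndlambda_graph (R : realType) (V : finType) (e : rel V) (n d : nat)
    (lambda : R) : Prop :=
  [/\ #|V| = n, regular_graph e d &
      exists2 s : seq R, eigenvalue_seq (adjacency R e) s
        & {in behead s, forall x, `|x| <= lambda}].

(* Main.v *)
Require Import Defs.
From HB Require Import structures.
From mathcomp Require Import all_boot all_order all_algebra all_fingroup.
From mathcomp Require Import boolp classical_sets reals.
From mathcomp Require Import topology normedtype sequences derive exp trigo.
From mathcomp Require Import complex spectral ring lra.

Set Implicit Arguments.
Unset Strict Implicit.
Unset Printing Implicit Defensive.

Import Order.TTheory GRing.Theory Num.Theory.
Import numFieldNormedType.Exports.
Local Open Scope ring_scope.

(* Let [M = A - (d/n) J]. Up to a factor 4, uniformity bounds [sum M x y * f x * g y]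
   over all [f, g] with values in [-1, 1]. By Grothendieck's inequality with
   constant 2 the same bound, doubled, holds for [sum M x y * <u x, v y>] with unit
   vectors [u x], [v y]. If [M f = mu f], the normalised right translates
   [u x = (g |-> f (x g)) / |f|] are unit vectors, and since [M] is invariant under
   right translation the sum equals [n * mu]; hence [n |mu| <= 2 * 4 * eps d n].

   For the constant 2, draw independent signs with mean [sin (c <xi, u>)], [xi]
   Gaussian, and take the majority of 25 of them. This is a bounded function of
   [u] which is an odd trigonometric polynomial, so its correlations are
   [Phi <u, v>] with [Phi] an explicit series with nonnegative coefficients, and
   [|form M (Phi X)| <= C] for every correlation matrix [X = (<u x, v y>)].
   Substituting the correlation matrix [(9 X - X^3) / 10], which approximately
   inverts [Phi], gives [q X + error] with [q > 1/2], where the error is small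
   compared to the supremum [B] of [form M] over correlation matrices: this reads
   [B <= 19/10 C + B/20]. The Gaussian is a limit of sums of signs, so only
   finite averages of cosines are needed. *)

(** * Cosines and Gaussian averages *)

Section CosGaussian.
Local Open Scope classical_set_scope.
Variable R : realType.
Implicit Types x y w : R.

Lemma sin_mvt x : 0 <= x -> exists2 c, 0 <= c <= x & sin x = cos c * x.
Proof.
move=> x0.
have [|c] := @MVT_segment R sin cos 0 x x0 (fun y _ => is_derive_sin y).
  by apply: continuous_subspaceT => y; exact: continuous_sin.
by rewrite in_itv/= sin0 !subr0 => cI sE; exists c.
Qed.

Lemma sqr_sin_le x : sin x ^+ 2 <= x ^+ 2.
Proof.
wlog x0 : x / 0 <= x.
  move=> H; have [/H //|/ltW x0] := leP 0 x.
  by rewrite -[in leLHS](opprK x) sinN !sqrrN -(sqrrN x) H // oppr_ge0.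
have [c _ ->] := sin_mvt x0.
rewrite exprMn ler_piMl ?sqr_ge0 //.
by rewrite -real_normK ?num_real// expr_le1// cos_max.
Qed.

Lemma cos_ge x : 1 - x ^+ 2 / 2 <= cos x.
Proof.
have -> : cos x = 1 - 2 * sin (x / 2) ^+ 2.
  by rewrite {1}[x](_ : _ = (x / 2) *+ 2) ?cos_mulr2n ?cos2sin2; [ring|field].
have := sqr_sin_le (x / 2); rewrite expr_div_n; lra.
Qed.

(** On [[0, 1]], [sin x = cos c * x] with [cos c >= 1 - x ^+ 2 / 2], whose square is at least
    [1 - x ^+ 2]. Beyond [1] the left side is negative. *)
Lemma sqr_sin_ge x : x ^+ 2 - x ^+ 4 <= sin x ^+ 2.
Proof.
wlog x0 : x / 0 <= x.
  move=> H; have [/H //|/ltW x0] := leP 0 x.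
  by rewrite -[in leRHS](opprK x) sinN sqrrN -(sqrrN x)
     (_ : x ^+ 4 = (- x) ^+ 4) ?H ?oppr_ge0 //; ring.
have [c /andP[c0 cx] ->] := sin_mvt x0.
have [x1|x1] := leP x 1; last first.
  apply: le_trans (sqr_ge0 _); rewrite subr_le0 (_ : 4 = 2 + 2)%N// exprD.
  by rewrite ler_peMl ?sqr_ge0// exprn_ege1// ltW.
have : 1 - x ^+ 2 / 2 <= cos c by apply: le_trans (cos_ge c); nra.
rewrite exprMn => h.
have : (1 - x ^+ 2 / 2) ^+ 2 <= cos c ^+ 2.
  rewrite ler_sqr ?nnegrE//; first by nra.
  by apply: le_trans h; nra.
nra.
Qed.

Lemma cos_le x : cos x <= 1 - x ^+ 2 / 2 + x ^+ 4 / 8.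
Proof.
have -> : cos x = 1 - 2 * sin (x / 2) ^+ 2.
  by rewrite {1}[x](_ : _ = (x / 2) *+ 2) ?cos_mulr2n ?cos2sin2; [ring|field].
have := sqr_sin_ge (x / 2); rewrite !expr_div_n; lra.
Qed.

Lemma cos_le_gauss x : cos x <= expR (- (x ^+ 2 / 2) + x ^+ 4).
Proof.
apply: le_trans (expR_ge1Dx _); apply: le_trans (cos_le x) _.
have : 0 <= x ^+ 4 by rewrite (exprM x 2 2) sqr_ge0.
lra.
Qed.

Lemma cos_ge_gauss x : `|x| <= 1 -> expR (- (x ^+ 2 / 2) - x ^+ 4) <= cos x.
Proof.
move=> x1; apply: le_trans (cos_ge x).
have : x ^+ 2 <= 1 by rewrite -real_normK ?num_real// expr_le1.
rewrite (exprM x 2 2); set z := x ^+ 2 => z1.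
have z0 : 0 <= z by exact: sqr_ge0.
rewrite -[_ - _]opprK expRN invf_ple ?posrE ?expR_gt0//; last by lra.
apply: le_trans (expR_ge1Dx _).
rewrite -[leLHS]mul1r ler_pdivrMr; [nra|lra].
Qed.

(** The central limit theorem for signs, on characteristic functions: raised to the power [N.+1],
    the two Gaussian bounds on [cos] miss the limit only by [w ^+ 4 / N.+1] in the exponent. *)
Lemma cvg_cos_pow w :
  (fun N : nat => cos (w / Num.sqrt N.+1%:R) ^+ N.+1) @ \oo
    --> expR (- (w ^+ 2 / 2)).
Proof.
have hN N : Num.sqrt (N.+1%:R : R) ^+ 2 = N.+1%:R by rewrite sqr_sqrtr.
have h4 N : (w / Num.sqrt N.+1%:R) ^+ 4 *+ N.+1 = w ^+ 4 * harmonic N.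
  rewrite -mulr_natr expr_div_n (exprM (Num.sqrt _) 2 2) hN /harmonic/=; field.
  by rewrite ?nat1r ?pnatr_eq0.
have h2 N : (w / Num.sqrt N.+1%:R) ^+ 2 / 2 *+ N.+1 = w ^+ 2 / 2.
  rewrite -mulr_natr expr_div_n hN; field.
  by rewrite ?nat1r ?pnatr_eq0.
have cvgE (s : R) : (fun N => expR (- (w ^+ 2 / 2) + s * (w ^+ 4 * harmonic N))) @ \oo
    --> expR (- (w ^+ 2 / 2)).
  suff h : (fun N => - (w ^+ 2 / 2) + s * (w ^+ 4 * harmonic N)) @ \oo
      --> - (w ^+ 2 / 2).
    by apply: continuous_cvg h; exact: continuous_expR.
  rewrite -[X in _ --> X]addr0; apply: cvgD; first exact: cvg_cst.
  rewrite -(mulr0 s); apply: cvgM; first exact: cvg_cst.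
  rewrite -(mulr0 (w ^+ 4)); apply: cvgM; first exact: cvg_cst.
  exact: cvg_harmonic.
apply: (@squeeze_cvgr _ _ _ _
  (fun N => expR (- (w ^+ 2 / 2) + (-1) * (w ^+ 4 * harmonic N)))
  (fun N => expR (- (w ^+ 2 / 2) + 1 * (w ^+ 4 * harmonic N)))); [|exact: cvgE..].
near=> N.
have wN : `|w / Num.sqrt N.+1%:R| <= 1.
  rewrite normrM normfV [X in _ / X]ger0_norm ?sqrtr_ge0//.
  rewrite ler_pdivrMr ?sqrtr_gt0// mul1r -[leLHS]sqrtr_sqr ler_wsqrtr//.
  near: N; exists (Num.truncn (w ^+ 2)) => // N/= hle.
  by apply: (le_trans (ltW (truncnS_gt _))); rewrite ler_nat.
have c0 : 0 <= cos (w / Num.sqrt N.+1%:R).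
  by apply: le_trans (cos_ge_gauss wN); exact: expR_ge0.
apply/andP; split.
  rewrite mulN1r -(h2 N) -(h4 N) -mulNrn -mulrnBl -[X in expR X]mulr_natl expRM_natl.
  by rewrite lerXn2r ?nnegrE ?expR_ge0// cos_ge_gauss.
rewrite mul1r -(h2 N) -(h4 N) -mulNrn -mulrnDl -[X in expR X]mulr_natl expRM_natl.
by rewrite lerXn2r ?nnegrE ?expR_ge0// cos_le_gauss.
Unshelve. all: by end_near. Qed.

End CosGaussian.

(** * Averages over sums of random signs *)

Section Averages.
Variables (R : realType) (I : finType).
Implicit Types (s : seq I) (F : (I -> R) -> R) (z w : I -> R).

Definition step (a : R) (i : I) (z : I -> R) : I -> R :=
  fun k => z k + a * (k == i)%:R.

(** The expectation of [F] at a sum of independent random signs times basis vectors, one for each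
    entry of [s]; a repeated index adds a further sign to its coordinate. *)
Fixpoint avg s F : R :=
  if s is i :: s' then
    (avg s' (F \o step 1 i) + avg s' (F \o step (-1) i)) / 2
  else F (fun=> 0).

Lemma avg_sum (J : Type) (r : seq J) s (F : J -> (I -> R) -> R) :
  avg s (fun z => \sum_(j <- r) F j z) = \sum_(j <- r) avg s (F j).
Proof.
elim: s F => [//|i s IH] F /=.
by rewrite !(IH (fun j => F j \o _)) -big_split/= mulr_suml.
Qed.

Lemma avgZ s (a : R) F : avg s (fun z => a * F z) = a * avg s F.
Proof.
by elim: s F => [//|i s IH] F /=; rewrite !(IH (F \o _)) -mulrDr mulrA.
Qed.

Lemma norm_avg s F (C : R) : (forall z, `|F z| <= C) -> `|avg s F| <= C.
Proof.
elim: s F => [|i s IH] F FC /=; first exact: FC.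
have h1 := IH (F \o step 1 i) (fun z => FC _).
have h2 := IH (F \o step (-1) i) (fun z => FC _).
rewrite normrM [X in _ * X]ger0_norm; last lra.
by have := ler_normD (avg s (F \o step 1 i)) (avg s (F \o step (-1) i)); lra.
Qed.

Definition lin z w : R := \sum_i z i * w i.

Lemma lin_step a i z w : lin (step a i z) w = lin z w + a * w i.
Proof.
rewrite /lin /step; under eq_bigr do rewrite mulrDl.
rewrite big_split/=; congr (_ + _).
rewrite (bigD1 i)//= eqxx mulr1 big1 ?addr0// => k /negPf ->.
by rewrite mulr0 mul0r.
Qed.

(** The shift [t] makes the induction work: a sign moves [t] to [t + w i] or [t - w i], and the two
    cosines average to [cos t * cos (w i)]. *)
Lemma avg_cos_shift s (t : R) w :
  avg s (fun z => cos (t + lin z w)) = cos t * \prod_(i <- s) cos (w i).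
Proof.
elim: s t => [|i s IH] t /=.
  by rewrite big_nil /lin big1 ?addr0 ?mulr1// => k _; rewrite mul0r.
have E a : (fun z => cos (t + lin z w)) \o step a i =
    (fun z => cos ((t + a * w i) + lin z w)).
  by apply/funext => z /=; rewrite lin_step; congr cos; ring.
by rewrite !E !IH big_cons !cosD mulN1r mul1r cosN sinN; field.
Qed.

Lemma avg_cos s w : avg s (fun z => cos (lin z w)) = \prod_(i <- s) cos (w i).
Proof.
rewrite -[RHS]mul1r -{1}(@cos0 R) -avg_cos_shift.
by congr avg; apply/funext => z; rewrite add0r.
Qed.

Lemma avg_sin_sin s w w' :
  avg s (fun z => sin (lin z w) * sin (lin z w')) =
  (\prod_(i <- s) cos (w i - w' i) - \prod_(i <- s) cos (w i + w' i)) / 2.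
Proof.
rewrite -!avg_cos.
(* The product-to-sum formula is written as a sum over two booleans so that [avg_sum] applies. *)
have -> : (fun z => sin (lin z w) * sin (lin z w')) = (fun z => \sum_(b <- [:: true; false])
   (if b then 2^-1 * cos (lin z (fun i => w i - w' i)) else - 2^-1 * cos (lin z (fun i => w i + w' i)))).
  apply/funext => z; rewrite !big_cons big_nil.
  have -> : lin z (fun i => w i - w' i) = lin z w - lin z w'.
    by rewrite /lin -sumrB; apply: eq_bigr => i _; ring.
  have -> : lin z (fun i => w i + w' i) = lin z w + lin z w'.
    by rewrite /lin -big_split; apply: eq_bigr => i _ /=; ring.
  by rewrite cosB cosD; field.
by rewrite avg_sum !big_cons big_nil !avgZ; field.
Qed.

End Averages.

(** * Limits of finite sums and products, and the Gaussian limit *)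

Section Limits.
Local Open Scope classical_set_scope.
Variable R : realType.

Lemma cvg_sumr (J : Type) (r : seq J) (f : J -> nat -> R) (l : J -> R) :
  (forall j, f j @ \oo --> l j) ->
  (fun n => \sum_(j <- r) f j n) @ \oo --> \sum_(j <- r) l j.
Proof.
move=> fl; elim: r => [|j r IH].
  rewrite big_nil [X in X @ _](_ : _ = fun=> 0); first exact: cvg_cst.
  by apply/funext => n; rewrite big_nil.
rewrite big_cons [X in X @ _](_ : _ = fun n => f j n + \sum_(j <- r) f j n).
  exact: cvgD.
by apply/funext => n; rewrite big_cons.
Qed.

Lemma cvg_prodr (J : Type) (r : seq J) (f : J -> nat -> R) (l : J -> R) :
  (forall j, f j @ \oo --> l j) ->
  (fun n => \prod_(j <- r) f j n) @ \oo --> \prod_(j <- r) l j.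
Proof.
move=> fl; elim: r => [|j r IH].
  rewrite big_nil [X in X @ _](_ : _ = fun=> 1); first exact: cvg_cst.
  by apply/funext => n; rewrite big_nil.
rewrite big_cons [X in X @ _](_ : _ = fun n => f j n * \prod_(j <- r) f j n).
  exact: cvgM.
by apply/funext => n; rewrite big_cons.
Qed.

Lemma norm_cvg_le (f : nat -> R) (l C : R) :
  f @ \oo --> l -> (forall n, `|f n| <= C) -> `|l| <= C.
Proof.
move=> fl fC.
have h : (fun n => `|f n|) @ \oo --> `|l| by exact: cvg_norm.
rewrite -(cvg_lim _ h)//; apply: limr_le; first by apply/cvg_ex; exists `|l|.
by apply: nearW => n; exact: fC.
Qed.

(** Each coordinate receives [n.+1] signs; after division by [Num.sqrt n.+1%:R] the random vector
    tends in law to a standard Gaussian. *)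
Definition signs (I : finType) (n : nat) : seq I :=
  flatten (nseq n.+1 (enum I)).

Lemma prod_signs (I : finType) (n : nat) (f : I -> R) :
  \prod_(i <- signs I n) f i = \prod_i f i ^+ n.+1.
Proof.
rewrite /signs; elim: n.+1 => [|k IH] /=.
  by rewrite big_nil big1// => i _; rewrite expr0.
rewrite big_cat /= IH big_enum -big_split /=.
by apply: eq_bigr => i _; rewrite exprS.
Qed.

Lemma cvg_prod_cos (I : finType) (w : I -> R) :
  (fun n => \prod_(i <- signs I n) cos (w i / Num.sqrt n.+1%:R)) @ \oo
    --> expR (- (\sum_i w i ^+ 2) / 2).
Proof.
rewrite [X in X @ _](_ : _ = fun n =>
    \prod_(i <- index_enum I) cos (w i / Num.sqrt n.+1%:R) ^+ n.+1); last first.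
  by apply/funext => n; rewrite prod_signs.
rewrite -sumrN mulr_suml expR_sum; apply: cvg_prodr => i.
by rewrite mulNr; exact: cvg_cos_pow.
Qed.

End Limits.

(** * Rounding unit vectors *)

Section Rounding.
Local Open Scope classical_set_scope.
Variables (R : realType) (V W : finType).
Implicit Types (M X : V -> W -> R) (t C : R).

Definition form M X : R := \sum_x \sum_y M x y * X x y.

Definition cube_bound M C := forall (f : V -> R) (g : W -> R),
  (forall x, `|f x| <= 1) -> (forall y, `|g y| <= 1) ->
  `|form M (fun x y => f x * g y)| <= C.

(** The finite index set [I] is left free so that direct sums and tensor products of vectors stay
    within the class. *)
Definition correlation X := exists (I : finType) (u : V -> I -> R) (v : W -> I -> R),
  [/\ forall x, \sum_i u x i ^+ 2 = 1, forall y, \sum_i v y i ^+ 2 = 1 &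
      forall x y, X x y = \sum_i u x i * v y i].

Variables (m : nat) (b k : 'I_m -> R).

(** With [h s = \sum_i b i * sin (k i * s)], [xi] a standard Gaussian and unit vectors with
    [<u, v> = t], this is the expectation of [h <xi, u> * h <xi, v>]. *)
Definition kernel t : R := \sum_i \sum_j b i * b j *
  ((expR (- (k i ^+ 2 + k j ^+ 2 - 2 * k i * k j * t) / 2) -
    expR (- (k i ^+ 2 + k j ^+ 2 + 2 * k i * k j * t) / 2)) / 2).

Lemma avg_form M (I : finType) (s : seq I) (F : V -> W -> (I -> R) -> R) :
  avg s (fun z => form M (fun x y => F x y z)) =
  form M (fun x y => avg s (F x y)).
Proof.
rewrite /form avg_sum; apply: eq_bigr => x _.
by rewrite avg_sum; apply: eq_bigr => y _; rewrite avgZ.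
Qed.

Lemma cvg_form M (X : nat -> V -> W -> R) (Y : V -> W -> R) :
  (forall x y, (fun n => X n x y) @ \oo --> Y x y) ->
  (fun n => form M (X n)) @ \oo --> form M Y.
Proof.
move=> XY; apply: cvg_sumr => x; apply: cvg_sumr => y.
by apply: cvgM; [exact: cvg_cst|exact: XY].
Qed.

(** For every outcome of the signs, [h] of the projections is admissible in [cube_bound]; averaging
    keeps the bound, and the averages converge to [kernel (X x y)]. *)
Lemma kernel_bound M X C :
  (forall t, `|\sum_i b i * sin (k i * t)| <= 1) ->
  cube_bound M C -> correlation X ->
  `|form M (fun x y => kernel (X x y))| <= C.
Proof.
move=> hb MC [I [u [v [u1 v1 XE]]]].
pose h t := \sum_i b i * sin (k i * t).
pose c n : R := Num.sqrt n.+1%:R.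
pose G n x y := avg (signs I n) (fun z =>
  h (lin z (fun i => u x i / c n)) * h (lin z (fun i => v y i / c n))).
apply: (@norm_cvg_le _ (fun n => form M (G n))); last first.
  by move=> n; rewrite -avg_form; apply: norm_avg => z; apply: MC => ?; exact: hb.
apply: cvg_form => x y.
have -> : (fun n => G n x y) = (fun n => \sum_i \sum_j b i * b j *
    ((\prod_(l <- signs I n) cos ((k i * u x l - k j * v y l) / c n) -
      \prod_(l <- signs I n) cos ((k i * u x l + k j * v y l) / c n)) / 2)).
  apply/funext => n; rewrite /G.
  have linZ z (a : R) w : a * lin z (fun i => w i / c n) = lin z (fun i => a * w i / c n).
    by rewrite /lin mulr_sumr; apply: eq_bigr => l _; ring.
  rewrite [X in avg _ X](_ : _ = fun z => \sum_i \sum_j (b i * b j) *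
    (sin (lin z (fun l => k i * u x l / c n)) * sin (lin z (fun l => k j * v y l / c n)))); last first.
    apply/funext => z; rewrite mulr_suml; apply: eq_bigr => i _.
    by rewrite mulr_sumr; apply: eq_bigr => j _; rewrite !linZ; ring.
  rewrite avg_sum; apply: eq_bigr => i _; rewrite avg_sum; apply: eq_bigr => j _.
  rewrite avgZ avg_sin_sin; do 2 congr (_ * _); congr (_ - _).
    by apply: eq_bigr => l _; rewrite mulrBl.
  by apply: eq_bigr => l _; rewrite mulrDl.
have nE (a c' : R) : \sum_l (a * u x l + c' * v y l) ^+ 2 =
    a ^+ 2 + c' ^+ 2 + 2 * a * c' * X x y.
  rewrite -[a ^+ 2]mulr1 -[c' ^+ 2]mulr1
    -[X in _ * X + _ + _](u1 x) -[X in _ + _ * X + _](v1 y) XE !mulr_sumr -!big_split.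
  by apply: eq_bigr => l _ /=; ring.
apply: cvg_sumr => i; apply: cvg_sumr => j.
apply: cvgM; first exact: cvg_cst.
apply: cvgM; last exact: cvg_cst.
apply: cvgB; last by rewrite -nE; exact: cvg_prod_cos.
(* The difference is treated as a sum with frequency [- k j], which [nE] covers. *)
rewrite (_ : _ - _ = k i ^+ 2 + (- k j) ^+ 2 + 2 * k i * (- k j) * X x y); last by ring.
rewrite -nE [X in X @ _](_ : _ = fun n => \prod_(l <- signs I n)
  cos ((k i * u x l + - k j * v y l) / c n)); first exact: cvg_prod_cos.
by apply/funext => n; apply: eq_bigr => l _; rewrite mulNr.
Qed.

Definition kernel_moment (i : nat) : R := \sum_j b j * expR (- k j ^+ 2 / 2) * k j ^+ i.
Definition kernel_coef (i : nat) : R := (odd i)%:R * kernel_moment i ^+ 2 / i`!%:R.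

Lemma kernel_coef_ge0 i : 0 <= kernel_coef i.
Proof. by rewrite /kernel_coef divr_ge0// mulr_ge0// sqr_ge0. Qed.

Lemma cvg_sinh (z : R) :
  (fun n => \sum_(i < n) (odd i)%:R * z ^+ i / i`!%:R) @ \oo -->
  (expR z - expR (- z)) / 2.
Proof.
rewrite [X in X @ _](_ : _ = fun n => (series (exp_coeff z) n - series (exp_coeff (- z)) n) / 2); last first.
  apply/funext => n; rewrite /series/= !big_mkord -sumrB mulr_suml.
  apply: eq_bigr => i _; rewrite /exp_coeff/= exprNn -signr_odd.
  by case: (odd i) => /=; field; rewrite pnatr_eq0 -lt0n fact_gt0.
apply: cvgM; last exact: cvg_cst.
by apply: cvgB; exact: is_cvg_series_exp_coeff.
Qed.

(** Pulling out [expR (- k i ^+ 2 / 2)] and [expR (- k j ^+ 2 / 2)] leaves the hyperbolic sine of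
    [k i * k j * t]. In each degree of its Taylor series the double sum factors as the square of a
    moment, so no coefficient is negative. *)
Lemma cvg_kernel t : (fun n => \sum_(i < n) kernel_coef i * t ^+ i) @ \oo --> kernel t.
Proof.
have -> : kernel t = \sum_i \sum_j b i * b j * expR (- k i ^+ 2 / 2) * expR (- k j ^+ 2 / 2) *
    ((expR (k i * k j * t) - expR (- (k i * k j * t))) / 2).
  apply: eq_bigr => i _; apply: eq_bigr => j _.
  rewrite (_ : - (_ - _) / 2 = - k i ^+ 2 / 2 + (- k j ^+ 2 / 2) + k i * k j * t); last by field.
  rewrite (_ : - (_ + 2 * _ * _ * _) / 2 = - k i ^+ 2 / 2 + (- k j ^+ 2 / 2) + - (k i * k j * t)); last by field.
  by rewrite !expRD; ring.
rewrite [X in X @ _](_ : _ = fun n => \sum_i \sum_j b i * b j *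
   expR (- k i ^+ 2 / 2) * expR (- k j ^+ 2 / 2) *
   (\sum_(l < n) (odd l)%:R * (k i * k j * t) ^+ l / l`!%:R)).
  apply: cvg_sumr => i; apply: cvg_sumr => j.
  by apply: cvgM; [exact: cvg_cst|exact: cvg_sinh].
apply/funext => n.
under [RHS]eq_bigr do under eq_bigr do rewrite mulr_sumr.
under [RHS]eq_bigr do rewrite exchange_big.
rewrite exchange_big; apply: eq_bigr => l _.
rewrite /kernel_coef /kernel_moment expr2 mulr_sumr mulr_sumr !mulr_suml; apply: eq_bigr => i _.
rewrite mulr_suml mulr_sumr !mulr_suml; apply: eq_bigr => j _.
by rewrite !exprMn; ring.
Qed.

End Rounding.

(** * Operations on correlation matrices *)

Section Correlations.
Local Open Scope classical_set_scope.
Variables (R : realType) (V W : finType).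
Implicit Types (X Y M : V -> W -> R).

Lemma correlation1 : correlation (fun (_ : V) (_ : W) => 1 : R).
Proof.
exists unit, (fun _ _ => 1), (fun _ _ => 1).
by split=> *; rewrite sumr_const card_unit !(expr1n, mulr1).
Qed.

(** Tensor products of the vectors. *)
Lemma correlationM X Y : correlation X -> correlation Y ->
  correlation (fun x y => X x y * Y x y).
Proof.
move=> [I [u [v [u1 v1 XE]]]] [J [u' [v' [u1' v1' YE]]]].
exists (I * J)%type, (fun x p => u x p.1 * u' x p.2), (fun y p => v y p.1 * v' y p.2).
split=> [x|y|x y].
- rewrite -(pair_bigA _ (fun i j => (u x i * u' x j) ^+ 2)) /= -[1]mulr1.
  rewrite -[X in _ = X * _](u1 x) -[X in _ = _ * X](u1' x) big_distrlr/=.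
  by do 2 (apply: eq_bigr => ? _); rewrite exprMn.
- rewrite -(pair_bigA _ (fun i j => (v y i * v' y j) ^+ 2)) /= -[1]mulr1.
  rewrite -[X in _ = X * _](v1 y) -[X in _ = _ * X](v1' y) big_distrlr/=.
  by do 2 (apply: eq_bigr => ? _); rewrite exprMn.
- rewrite -(pair_bigA _ (fun i j => (u x i * u' x j) * (v y i * v' y j))) /=.
  rewrite XE YE big_distrlr/=.
  by do 2 (apply: eq_bigr => ? _); rewrite mulrACA.
Qed.

Lemma correlationX X n : correlation X -> correlation (fun x y => X x y ^+ n).
Proof.
move=> XC; elim: n => [|n IH]; first exact: correlation1.
rewrite (_ : (fun _ _ => _) = fun x y => X x y * X x y ^+ n).
  exact: correlationM.
by apply/funext => x; apply/funext => y; rewrite exprS.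
Qed.

(** Direct sums of the vectors, scaled by [Num.sqrt p] and [Num.sqrt r]; the minus sign is put into
    the second family only. *)
Lemma correlation_comb X Y (p r : R) : 0 <= p -> 0 <= r -> p + r = 1 ->
  correlation X -> correlation Y ->
  correlation (fun x y => p * X x y - r * Y x y).
Proof.
move=> p0 r0 pr1 [I [u [v [u1 v1 XE]]]] [J [u' [v' [u1' v1' YE]]]].
exists (I + J)%type.
exists (fun x k => match k with inl i => Num.sqrt p * u x i
                              | inr j => Num.sqrt r * u' x j end).
exists (fun y k => match k with inl i => Num.sqrt p * v y i
                              | inr j => - Num.sqrt r * v' y j end).
have sp := sqr_sqrtr p0; have sr := sqr_sqrtr r0.
split=> [x|y|x y]; rewrite big_sumType/=.
- under eq_bigr do rewrite exprMn sp.
  under [X in _ + X]eq_bigr do rewrite exprMn sr.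
  by rewrite -!mulr_sumr u1 u1' !mulr1.
- under eq_bigr do rewrite exprMn sp.
  under [X in _ + X]eq_bigr do rewrite exprMn sqrrN sr.
  by rewrite -!mulr_sumr v1 v1' !mulr1.
- rewrite XE YE !mulr_sumr -sumrN; congr (_ + _); apply: eq_bigr => i _.
    by rewrite -[X in X * _ = _]sp; ring.
  by rewrite -[X in - (X * _) = _]sr; ring.
Qed.

Lemma correlation_norm X : correlation X -> forall x y, `|X x y| <= 1.
Proof.
move=> [I [u [v [u1 v1 XE]]]] x y; rewrite XE.
have h (e : R) : e ^+ 2 = 1 -> e * \sum_i u x i * v y i <= 1.
  move=> e1.
  have : 0 <= \sum_i (u x i - e * v y i) ^+ 2 by apply: sumr_ge0 => i _; exact: sqr_ge0.
  have -> : \sum_i (u x i - e * v y i) ^+ 2 = \sum_i u x i ^+ 2 + e ^+ 2 * (\sum_i v y i ^+ 2)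
      - 2 * (e * \sum_i u x i * v y i).
    rewrite !mulr_sumr -sumrN -!big_split/=; apply: eq_bigr => i _; ring.
  by rewrite u1 v1 e1; lra.
have := h (-1) (sqrr_sign _ 1); have := h 1 (expr1n _ _).
by rewrite ler_norml; move=> *; apply/andP; split; lra.
Qed.

Lemma form_le_norm M X : (forall x y, `|X x y| <= 1) ->
  form M X <= \sum_x \sum_y `|M x y|.
Proof.
move=> X1; apply: ler_sum => x _; apply: ler_sum => y _.
by apply: le_trans (ler_norm _) _; rewrite normrM ler_piMr.
Qed.

Lemma formN M X : form M (fun x y => - X x y) = - form M X.
Proof.
rewrite /form -sumrN; apply: eq_bigr => x _; rewrite -sumrN.
by apply: eq_bigr => y _; rewrite mulrN.
Qed.

Lemma form_sum M (n : nat) (X : 'I_n -> V -> W -> R) :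
  form M (fun x y => \sum_(i < n) X i x y) = \sum_(i < n) form M (X i).
Proof.
rewrite /form; under eq_bigr do under eq_bigr do rewrite mulr_sumr.
under eq_bigr do rewrite exchange_big.
by rewrite exchange_big.
Qed.

Lemma formZ M (a : R) X : form M (fun x y => a * X x y) = a * form M X.
Proof.
rewrite /form mulr_sumr; apply: eq_bigr => x _; rewrite mulr_sumr.
by apply: eq_bigr => y _; rewrite mulrCA.
Qed.

Lemma form_binomial M X (p r : R) n :
  form M (fun x y => (p * X x y - r * X x y ^+ 3) ^+ n) =
  \sum_(j < n.+1) 'C(n, j)%:R * p ^+ (n - j) * (- r) ^+ j *
     form M (fun x y => X x y ^+ (n - j + 3 * j)).
Proof.
under [RHS]eq_bigr do rewrite -formZ.
rewrite -form_sum; apply: eq_bigr => x _; apply: eq_bigr => y _; congr (_ * _).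
rewrite -mulNr exprDn; apply: eq_bigr => j _.
rewrite 2!exprMn exprD exprM -mulr_natl -!mulrA; congr (_ * (_ * _)).
by rewrite mulrCA.
Qed.

(** Replacing the Taylor coefficients by lower bounds [l] leaves a series with nonnegative
    coefficients of total mass [kernel b k 1 - \sum_(i < D) l i]. Powers of [X] are correlation
    matrices, so each unit of mass costs at most [B]. *)
Lemma kernel_self_bound m (b k : 'I_m -> R) M X (C B : R) (l : nat -> R) D :
  (forall t, `|\sum_i b i * sin (k i * t)| <= 1) ->
  cube_bound M C -> correlation X ->
  (forall Y, correlation Y -> `|form M Y| <= B) ->
  (forall i, l i <= kernel_coef b k i) -> (forall i, (D <= i)%N -> l i = 0) ->
  `|\sum_(i < D) l i * form M (fun x y => X x y ^+ i)| <=
    C + B * (kernel b k 1 - \sum_(i < D) l i).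
Proof.
move=> hb MC XC MB lk l0.
pose a i := form M (fun x y => X x y ^+ i).
pose f n := \sum_(i < n) (kernel_coef b k i - l i) * a i.
pose g n := \sum_(i < n) (kernel_coef b k i - l i).
have lcvg (c : nat -> R) : (fun n => \sum_(i < n) l i * c i) @ \oo --> \sum_(i < D) l i * c i.
  apply: cvg_near_cst; exists D => // n /= Dn.
  rewrite -(subnKC Dn) big_split_ord/= [X in _ + X]big1 ?addr0// => i _.
  by rewrite l0 ?mul0r// leq_addr.
have fE : f = fun n => \sum_(i < n) kernel_coef b k i * a i - \sum_(i < n) l i * a i.
  by apply/funext => n; rewrite /f -sumrB; apply: eq_bigr => i _; rewrite mulrBl.
have gE : g = fun n => \sum_(i < n) kernel_coef b k i * 1 ^+ i - \sum_(i < n) l i * 1.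
  by apply/funext => n; rewrite /g -sumrB; apply: eq_bigr => i _; rewrite expr1n !mulr1.
have fcvg : f @ \oo --> form M (fun x y => kernel b k (X x y)) - \sum_(i < D) l i * a i.
  rewrite fE; apply: cvgB; last exact: lcvg.
  rewrite [X in X @ _](_ : _ = fun n => form M (fun x y => \sum_(i < n) kernel_coef b k i * X x y ^+ i)).
    by apply: cvg_form => x y; exact: cvg_kernel.
  by apply/funext => n; rewrite form_sum; apply: eq_bigr => i _; rewrite formZ.
have gcvg : g @ \oo --> kernel b k 1 - \sum_(i < D) l i.
  rewrite gE; apply: cvgB; first exact: cvg_kernel.
  have -> : \sum_(i < D) l i = \sum_(i < D) l i * 1 by apply: eq_bigr => i _; rewrite mulr1.
  exact: (lcvg (fun=> 1)).
have fg n : `|f n| <= B * g n.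
  rewrite mulr_sumr; apply: le_trans (ler_norm_sum _ _ _) _; apply: ler_sum => i _.
  rewrite normrM ger0_norm ?subr_ge0 ?lk// mulrC.
  by apply: ler_wpM2r; [rewrite subr_ge0 lk|apply: MB; exact: correlationX].
have fgl : `|form M (fun x y => kernel b k (X x y)) - \sum_(i < D) l i * a i| <=
    B * (kernel b k 1 - \sum_(i < D) l i).
  have h1 : (fun n => `|f n|) @ \oo -->
      `|form M (fun x y => kernel b k (X x y)) - \sum_(i < D) l i * a i|.
    exact: cvg_norm.
  have h2 : (fun n => B * g n) @ \oo --> B * (kernel b k 1 - \sum_(i < D) l i).
    by apply: cvgM => //; exact: cvg_cst.
  rewrite -(cvg_lim _ h1)// -(cvg_lim _ h2)//; apply: ler_lim.
  - by apply/cvg_ex; eexists; exact: h1.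
  - by apply/cvg_ex; eexists; exact: h2.
  - by apply: nearW => n; exact: fg.
move: (kernel_bound hb MC XC) fgl; set K := form _ _; set L := \sum_(i < D) _ => KC KL.
by have := ler_normB K (K - L); rewrite opprB addrC subrK; lra.
Qed.

End Correlations.

(** * The majority of 25 signs *)

Section MajorityRounding.
Variable R : realType.
Implicit Types s t : R.

(* The majority of 25 independent signs with mean [s = sin t] has mean
   [\sum_i maj_num i / 2 ^+ 46 * sin ((2 * i + 1) * t)], because its derivative in
   [t] is proportional to [cos t ^+ 25]. *)
Definition maj_num (R : pzRingType) (i : nat) : R := nth 0 [::
   2 ^+ 2 * 5 ^+ 4 * 7 ^+ 2 * 13 * 17 ^+ 2 * 19 ^+ 2 * 23 ^+ 2;
   2 ^+ 3 * 5 ^+ 4 * 7 * 13 * 17 ^+ 2 * 19 ^+ 2 * 23 ^+ 2;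
   2 ^+ 3 * 5 ^+ 2 * 7 * 11 * 13 * 17 ^+ 2 * 19 ^+ 2 * 23 ^+ 2;
   5 ^+ 4 * 11 * 13 * 17 ^+ 2 * 19 ^+ 2 * 23 ^+ 2;
   5 ^+ 4 * 7 * 11 * 13 * 17 * 19 ^+ 2 * 23 ^+ 2;
   2 ^+ 2 * 5 ^+ 4 * 7 * 13 * 17 * 19 ^+ 2 * 23 ^+ 2;
   2 ^+ 2 * 5 ^+ 4 * 7 ^+ 2 * 11 * 17 * 19 * 23 ^+ 2;
   2 * 5 ^+ 2 * 7 ^+ 2 * 11 * 13 * 17 * 19 * 23 ^+ 2;
   2 * 5 ^+ 4 * 7 * 11 * 13 * 19 * 23 ^+ 2;
   2 ^+ 2 * 5 ^+ 4 * 7 * 13 * 17 * 23 ^+ 2;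
   2 ^+ 2 * 5 ^+ 4 * 13 * 17 * 19 * 23;
   5 ^+ 4 * 7 * 13 * 17 * 19;
   7 * 13 * 17 * 19 * 23] i.

(* ['C(25, i)] for [i <= 12], factored to keep the unary literals small. *)
Definition half_binom (R : pzRingType) (i : nat) : R := nth 0 [::
   1;
   5 ^+ 2;
   2 ^+ 2 * 3 * 5 ^+ 2;
   2 ^+ 2 * 5 ^+ 2 * 23;
   2 * 5 ^+ 2 * 11 * 23;
   2 * 3 * 5 * 7 * 11 * 23;
   2 ^+ 2 * 5 ^+ 2 * 7 * 11 * 23;
   2 ^+ 2 * 5 ^+ 2 * 11 * 19 * 23;
   3 ^+ 2 * 5 ^+ 2 * 11 * 19 * 23;
   5 ^+ 2 * 11 * 17 * 19 * 23;
   2 ^+ 3 * 5 * 11 * 17 * 19 * 23;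
   2 ^+ 3 * 3 * 5 ^+ 2 * 17 * 19 * 23;
   2 ^+ 2 * 5 ^+ 2 * 7 * 17 * 19 * 23] i.

(** The expression of [sin ((2 * i + 1) * t)] in [s = sin t], by [sin (a + 2 * t) = 2 * cos (2 * t)
    * sin a - sin (a - 2 * t)]. *)
Fixpoint sin_poly (R : pzRingType) (s : R) (i : nat) : R :=
  match i with
  | 0 => s
  | 1 => 3 * s - 4 * s ^+ 3
  | (j.+1 as k).+1 => (2 - 4 * s ^+ 2) * sin_poly s k - sin_poly s j
  end.

Lemma sin_polyE (t : R) i : sin ((2 * i%:R + 1) * t) = sin_poly (sin t) i.
Proof.
have c2 : cos (2 * t) = 1 - 2 * sin t ^+ 2.
  by rewrite mulrC mulr_natr cos_mulr2n cos2sin2; ring.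
have rec (a : R) : sin (a + 2 * t) = (2 - 4 * sin t ^+ 2) * sin a - sin (a - 2 * t).
  by rewrite sinD sinB c2; ring.
elim/ltn_ind: i => -[|[|i]] IH /=.
- by rewrite mulr0 add0r mul1r.
- rewrite [X in sin X](_ : _ = t + 2 * t); last by ring.
  by rewrite rec (_ : t - 2 * t = - t) ?sinN; ring.
rewrite [X in sin X](_ : _ = (2 * i.+1%:R + 1) * t + 2 * t); last first.
  by rewrite -!natr1; ring.
rewrite rec IH // (_ : _ - 2 * t = (2 * i%:R + 1) * t) ?IH//.
by rewrite -!natr1; ring.
Qed.

(** Exactly [i] of the 25 signs are negative with probability ['C(25, i) * (1 + s) ^+ (25 - i) * (1
    - s) ^+ i / 2 ^+ 25], so the right side is [2 ^+ 46] times the mean of the majority. *)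
Lemma majority_fourier (A : comPzRingType) (s : A) :
  \sum_(0 <= i < 13) maj_num A i * sin_poly s i =
  2 ^+ 21 * \sum_(0 <= i < 13) half_binom A i *
     ((1 + s) ^+ (25 - i) * (1 - s) ^+ i - (1 + s) ^+ i * (1 - s) ^+ (25 - i)).
Proof. by rewrite /index_iota/= !big_cons !big_nil /maj_num /half_binom /=; ring. Qed.

(** The total probability, with [i] and [25 - i] paired. *)
Lemma half_binom_sum (A : comPzRingType) (s : A) :
  \sum_(0 <= i < 13) half_binom A i *
     ((1 + s) ^+ (25 - i) * (1 - s) ^+ i + (1 + s) ^+ i * (1 - s) ^+ (25 - i)) =
  2 ^+ 25.
Proof. by rewrite /index_iota/= !big_cons !big_nil /half_binom /=; ring. Qed.

Lemma half_binom_ge0 i : 0 <= half_binom R i.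
Proof.
by do 13?[case: i => [|i]]; rewrite /half_binom/= ?nth_nil// ?mulr_ge0 ?exprn_ge0.
Qed.

Definition maj_coef (i : nat) : R := maj_num R i / 2 ^+ 46.

Lemma majority_le1 t : `|\sum_(0 <= i < 13) maj_coef i * sin ((2 * i%:R + 1) * t)| <= 1.
Proof.
set s := sin t.
have -> : \sum_(0 <= i < 13) maj_coef i * sin ((2 * i%:R + 1) * t) =
    (\sum_(0 <= i < 13) maj_num R i * sin_poly s i) / 2 ^+ 46.
  rewrite mulr_suml; apply: eq_bigr => i _.
  by rewrite sin_polyE /maj_coef mulrAC.
rewrite majority_fourier normrM normfV [X in _ / X]ger0_norm ?exprn_ge0//.
rewrite ler_pdivrMr ?exprn_gt0// mul1r normrM [X in X * _]ger0_norm ?exprn_ge0//.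
rewrite (_ : 46 = 21 + 25)%N// exprD ler_wpM2l ?exprn_ge0// -(half_binom_sum s).
apply: le_trans (ler_norm_sum _ _ _) _; apply: ler_sum => i _.
rewrite normrM [X in X * _]ger0_norm ?half_binom_ge0//.
rewrite ler_wpM2l ?half_binom_ge0//; apply: le_trans (ler_normB _ _) _.
have s1 : 0 <= 1 + s by have := sin_geN1 t; rewrite -/s; lra.
have s2 : 0 <= 1 - s by have := sin_le1 t; rewrite -/s; lra.
by rewrite !ger0_norm ?mulr_ge0 ?exprn_ge0.
Qed.

End MajorityRounding.

(** * Numerical lower bounds for the moments *)

Section MajorityMoments.
Variable R : realType.

(** This is [kernel_moment] for the majority with the power of [Num.sqrt width] divided out, which
    makes every term rational. *)
Definition maj_moment (n : nat) : R :=
  \sum_(0 <= i < 13) maj_coef R i * (4 / 5) ^+ ((2 * i + 1) ^ 2) * (2 * i%:R + 1) ^+ n.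

(* [10 ^+ 7] times the values of [(4 / 5) ^+ ((2 * i + 1) ^ 2)], rounded down. *)
Definition gauss_sample (i : nat) : R :=
  nth 0 [:: 8 * 10 ^+ 6; 1342 * 10 ^+ 3 + 177; 378 * 10 ^+ 2 - 22; 178] i.

Lemma gauss_sample_le i :
  gauss_sample i / 10 ^+ 7 <= (4 / 5) ^+ ((2 * i + 1) ^ 2) :> R.
Proof.
case: i => [|[|[|[|i]]]]; rewrite /gauss_sample /=; [lra..|].
by rewrite nth_nil mul0r exprn_ge0//; lra.
Qed.

Lemma maj_num_ge0 i : 0 <= maj_num R i.
Proof.
by do 13?[case: i => [|i]]; rewrite /maj_num/= ?nth_nil// ?mulr_ge0 ?exprn_ge0.
Qed.

Lemma maj_coef_ge0 i : 0 <= maj_coef R i.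
Proof. by rewrite divr_ge0 ?maj_num_ge0 ?exprn_ge0. Qed.

Lemma maj_moment_ge_sample n :
  (\sum_(0 <= i < 4) maj_num R i * gauss_sample i * (2 * i%:R + 1) ^+ n) /
     (2 ^+ 46 * 10 ^+ 7) <= maj_moment n.
Proof.
rewrite /maj_moment (@big_cat_nat _ _ _ 4 0 13)//= -[leLHS]addr0 lerD//.
  rewrite mulr_suml; apply: ler_sum => i _.
  rewrite [leLHS](_ : _ = maj_coef R i * (gauss_sample i / 10 ^+ 7) * (2 * i%:R + 1) ^+ n).
    apply: ler_wpM2r; first by rewrite exprn_ge0// addr_ge0// mulr_ge0.
    by rewrite ler_wpM2l ?gauss_sample_le ?maj_coef_ge0.
  by rewrite /maj_coef invfM; ring.
apply: sumr_ge0 => i _.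
have q0 : 0 <= 4 / 5 :> R by lra.
have k0 : 0 <= 2 * i%:R + 1 :> R by rewrite addr_ge0// mulr_ge0.
by apply: mulr_ge0; [apply: mulr_ge0; [exact: maj_coef_ge0|]|]; exact: exprn_ge0.
Qed.

Lemma maj_moment_ge : [/\ [/\ 1 + 1458 / 10 ^+ 4 <= maj_moment 1,
  2366 / 1000 <= maj_moment 3 & 1451 / 100 <= maj_moment 5],
  153 <= maj_moment 7, 2151 <= maj_moment 9 &
  3990 * 10 <= maj_moment 11].
Proof.
split; [split|..]; apply: le_trans (maj_moment_ge_sample _);
  rewrite ler_pdivlMr ?mulr_gt0 ?exprn_gt0//;
  rewrite /index_iota/= !big_cons big_nil /maj_num /gauss_sample/=; lra.
Qed.

End MajorityMoments.

(** * Numerical bounds for the kernel at 1 *)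

Section MajorityEnergy.
Variable R : realType.

(* [10 ^+ 6] times the values of [(4 / 5) ^+ (4 * d ^ 2)], rounded up, resp. down. *)
Definition gauss_upper (d : nat) : R :=
  nth 1 [:: 10 ^+ 6; 2 ^+ 12 * 10 ^+ 2; 2 * 5 ^+ 2 * 563; 325] d.
Definition gauss_lower (d : nat) : R :=
  nth 0 [:: 0; 2 ^+ 12 * 10 ^+ 2; 60 * 469; 324] d.

Lemma gauss_upperP d : ((4 / 5) ^+ 4) ^+ (d ^ 2) <= gauss_upper d / 10 ^+ 6 :> R.
Proof.
case: d => [|[|[|[|d]]]]; rewrite /gauss_upper -exprM /=; [lra..|].
(* From [d = 4] on the default [1] stands for [1 / 10 ^+ 6], which exceeds [(4 / 5) ^+ 64]. *)
rewrite nth_nil.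
apply: (@le_trans _ _ ((4 / 5) ^+ (4 * 16))); last lra.
apply: ler_wiXn2l; [lra|lra|]. by rewrite leq_mul2l /= (leq_sqr 4).
Qed.

Lemma gauss_lowerP d : (0 < d)%N -> gauss_lower d / 10 ^+ 6 <= ((4 / 5) ^+ 4) ^+ (d ^ 2) :> R.
Proof.
case: d => [|[|[|[|d]]]] // _; rewrite /gauss_lower -exprM /=; [lra..|].
by rewrite nth_nil mul0r exprn_ge0//; lra.
Qed.

Definition energy_row_bound (i : nat) : R := nth 0 [:: 878; 900; 368; 157; 67; 26; 9; 3; 1; 1; 1; 1; 1] i.

(** With truncated subtraction, [(i - j) + (j - i)] is the distance of [i] and [j]. The row bounds
    are in thousandths. *)
Lemma maj_energy_row i : (i < 13)%N ->
  \sum_(0 <= j < 13) maj_num R j *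
    (gauss_upper ((i - j) + (j - i)) - gauss_lower (i + j + 1)) <=
  energy_row_bound i * 10 ^+ 3 * 2 ^+ 46.
Proof.
move=> i13; rewrite /index_iota/= !big_cons !big_nil.
by do 13?[case: i i13 => [|i] i13 //];
   rewrite /maj_num /gauss_upper /gauss_lower /energy_row_bound/=; lra.
Qed.

Lemma maj_energy_num :
  \sum_(0 <= i < 13) maj_num R i * energy_row_bound i <= 149 * 10 * 2 ^+ 46.
Proof.
rewrite /index_iota/= !big_cons !big_nil /maj_num /energy_row_bound/=.
lra.
Qed.

End MajorityEnergy.

(** * The constants of the rounding kernel *)

Section RoundingConstants.
Variable R : realType.

(* The variance of the Gaussian, chosen so that [expR (- (width / 2)) = 4 / 5] is rational. *)
Definition width : R := 2 * ln (5 / 4).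

Lemma width_ge : 446 / 1000 <= width.
Proof.
rewrite /width; suff : 223 / 1000 <= ln (5 / 4) :> R by lra.
rewrite -ler_expR lnK ?posrE; last lra.
rewrite -[leLHS]invrK -expRN invf_ple ?posrE ?invr_gt0 ?expR_gt0//; last lra.
(* The bound [expR x >= 1 + x] is too weak at [- (223 / 1000)]; it is applied after division by
   [2 ^+ 8]. *)
have -> : - (223 / 1000) = (- (223 / 1000 / 2 ^+ 8)) *+ (2 ^ 8) :> R.
  by rewrite -[RHS]mulr_natl natrX; field.
rewrite -[X in expR X]mulr_natl expRM_natl.
apply: (@le_trans _ _ ((1 - 223 / 1000 / 2 ^+ 8) ^+ (2 ^ 8))); last first.
  by rewrite lerXn2r ?nnegrE ?expR_ge0 ?expR_ge1Dx//; lra.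
lra.
Qed.

Lemma width_gt0 : 0 < width. Proof. by have := width_ge; lra. Qed.

Lemma expR_width n : expR (- (width / 2) * n%:R) = (4 / 5) ^+ n.
Proof.
rewrite mulrC expRM_natl; congr (_ ^+ _).
rewrite /width (_ : - _ = - ln (5 / 4)); last by field.
by rewrite expRN lnK ?posrE; [field|lra].
Qed.

(** Stretching the frequencies [2 * i + 1] by [Num.sqrt width] replaces a standard Gaussian by one
    of variance [width]. *)
Definition freq (i : 'I_13) : R := Num.sqrt width * (2 * i%:R + 1).

Definition maj_amplitude (i : 'I_13) : R := maj_coef R i.

Lemma sqr_sqrt_width : Num.sqrt width ^+ 2 = width.
Proof. by rewrite sqr_sqrtr ?ltW ?width_gt0. Qed.

Lemma majority_freq_le1 t : `|\sum_i maj_amplitude i * sin (freq i * t)| <= 1.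
Proof.
rewrite (eq_bigr (fun i : 'I_13 =>
  maj_coef R i * sin ((2 * i%:R + 1) * (Num.sqrt width * t)))).
  by rewrite -(big_mkord xpredT (fun i => maj_coef R i * sin ((2 * i%:R + 1) * _)));
     exact: majority_le1.
by move=> i _; rewrite /freq; congr (_ * sin _); ring.
Qed.

Lemma kernel_momentE n :
  kernel_moment maj_amplitude freq n = Num.sqrt width ^+ n * maj_moment R n.
Proof.
rewrite /kernel_moment /maj_moment big_mkord mulr_sumr; apply: eq_bigr => i _.
rewrite /freq [X in expR X](_ : _ = - (width / 2) * ((2 * i + 1) ^ 2)%:R); last first.
  by rewrite exprMn sqr_sqrt_width natrX natrD natrM; field.
by rewrite expR_width (exprMn _ (Num.sqrt _)) mulrCA.
Qed.

Lemma kernel_coefE n : odd n ->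
  kernel_coef maj_amplitude freq n = width ^+ n * maj_moment R n ^+ 2 / n`!%:R.
Proof.
move=> n_odd; rewrite /kernel_coef n_odd mul1r kernel_momentE exprMn -exprM mulnC exprM.
by rewrite sqr_sqrt_width.
Qed.

(** Up to the factor [Num.sqrt width], two frequencies differ by twice the distance of [i] and [j]
    and add up to [2 * (i + j + 1)], so every exponential is a power of [(4 / 5) ^+ 4]. *)
Lemma kernel1_le : kernel maj_amplitude freq 1 <= 745 / 1000.
Proof.
have kE (i j : 'I_13) : (expR (- (freq i ^+ 2 + freq j ^+ 2 - 2 * freq i * freq j * 1) / 2) -
    expR (- (freq i ^+ 2 + freq j ^+ 2 + 2 * freq i * freq j * 1) / 2)) / 2 <=
    (gauss_upper R ((i - j) + (j - i)) - gauss_lower R (i + j + 1)) / (2 * 10 ^+ 6).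
  rewrite [X in expR X - _](_ : _ = - (width / 2) * (4 * ((i - j) + (j - i)) ^ 2)%:R); last first.
    rewrite natrM; have -> : (((i - j) + (j - i)) ^ 2)%:R = (i%:R - j%:R) ^+ 2 :> R.
      have [ij|/ltnW ij] := leqP i j.
        have /eqP -> : (i - j == 0)%N by rewrite subn_eq0.
        by rewrite add0n natrX natrB// -sqrrN opprB.
      have /eqP -> : (j - i == 0)%N by rewrite subn_eq0.
      by rewrite addn0 natrX natrB.
    rewrite /freq; set c := Num.sqrt width.
    by rewrite -sqr_sqrt_width -/c; field.
  rewrite [X in _ - expR X](_ : _ = - (width / 2) * (4 * (i + j + 1) ^ 2)%:R); last first.
    rewrite /freq natrM natrX !natrD; set c := Num.sqrt width.
    by rewrite -sqr_sqrt_width -/c; field.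
  rewrite !expR_width 2!(exprM _ 4).
  have h1 := gauss_upperP R ((i - j) + (j - i)).
  have := @gauss_lowerP R (i + j + 1); rewrite {1}addn1 => /(_ isT) h2.
  by lra.
rewrite /kernel.
(* Rows are summed first; [maj_energy_num] then yields [1490 / 2000]. *)
apply: (@le_trans _ _ (\sum_(i < 13) maj_num R i * energy_row_bound R i / (2 * 1000 * 2 ^+ 46))).
  apply: ler_sum => i _.
  apply: (@le_trans _ _ ((\sum_(0 <= j < 13) maj_num R j *
    (gauss_upper R ((i - j) + (j - i)) - gauss_lower R (i + j + 1))) *
      (maj_num R i / (2 * 10 ^+ 6 * 2 ^+ 46 * 2 ^+ 46)))).
    rewrite big_mkord mulr_suml; apply: ler_sum => j _.
    apply: le_trans (ler_wpM2l _ (kE i j)) _.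
      by rewrite mulr_ge0 ?maj_coef_ge0.
    by rewrite /maj_amplitude /maj_coef !invfM le_eqVlt; apply/orP; left; apply/eqP; ring.
  apply: le_trans (ler_wpM2r _ (maj_energy_row R (ltn_ord i))) _.
    by rewrite divr_ge0 ?maj_num_ge0 ?mulr_ge0 ?exprn_ge0.
  by rewrite le_eqVlt; apply/orP; left; apply/eqP; field.
rewrite -mulr_suml -(big_mkord xpredT (fun i => maj_num R i * energy_row_bound R i)).
rewrite ler_pdivrMr ?mulr_gt0 ?exprn_gt0//.
by have := maj_energy_num R; lra.
Qed.

(** Indexed by degree. The entries add up to [0.7298], against at most [0.745] for the kernel at 1,
    so the neglected mass is at most [0.0152]. *)
Definition kernel_coef_lower (n : nat) : R := nth 0 [:: 0; 1171 / 2000; 0; 827 / 10 ^+ 4; 0;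
   309 / 10 ^+ 4; 0; 163 / 10 ^+ 4; 0; 89 / 10 ^+ 4; 0; 55 / 10 ^+ 4] n.

Lemma kernel_coef_ge n (r : R) : odd n -> 0 <= r -> r <= maj_moment R n ->
  (446 / 1000) ^+ n * r ^+ 2 / n`!%:R <= kernel_coef maj_amplitude freq n.
Proof.
move=> n_odd r0 rm; have W1 := width_ge.
rewrite kernel_coefE// ler_wpM2r ?invr_ge0// ler_pM ?exprn_ge0 ?lerXn2r ?nnegrE//.
all: lra.
Qed.

Lemma kernel_coef_lower_le n : kernel_coef_lower n <= kernel_coef maj_amplitude freq n.
Proof.
have [[m1 m3 m5] m7 m9 m11] := maj_moment_ge R.
do 12?[case: n => [|n]]; rewrite /kernel_coef_lower/= ?nth_nil ?kernel_coef_ge0//.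
- by apply: le_trans (kernel_coef_ge _ _ m1); rewrite ?factS ?fact0 //; lra.
- by apply: le_trans (kernel_coef_ge _ _ m3); rewrite ?factS ?fact0 ?natrM //; lra.
- by apply: le_trans (kernel_coef_ge _ _ m5); rewrite ?factS ?fact0 ?natrM //; lra.
- by apply: le_trans (kernel_coef_ge _ _ m7); rewrite ?factS ?fact0 ?natrM //; lra.
- by apply: le_trans (kernel_coef_ge _ _ m9); rewrite ?factS ?fact0 ?natrM //; lra.
- by apply: le_trans (kernel_coef_ge _ _ m11); rewrite ?factS ?fact0 ?natrM //; lra.
Qed.

End RoundingConstants.

(** * Grothendieck's inequality *)

Section Grothendieck.
Local Open Scope classical_set_scope.
Variables (R : realType) (V W : finType).
Implicit Types (X M : V -> W -> R).

Lemma grothendieck_contraction M X (C B : R) : cube_bound M C -> correlation X ->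
  (forall Y, correlation Y -> `|form M Y| <= B) ->
  form M X <= 19 / 10 * C + B / 20.
Proof.
move=> MC XC MB.
have C0 : 0 <= C.
  apply: (@le_trans _ _ `|form M (fun x y => (fun=> 0) x * (fun=> 0) y)|) => //.
  by apply: MC => *; rewrite normr0.
have B0 : 0 <= B := le_trans (normr_ge0 _) (MB _ XC).
pose a n := form M (fun x y => X x y ^+ n).
have aB n : - B <= a n <= B by rewrite -ler_norml; apply/MB/correlationX.
pose Y x y := 9 / 10 * X x y - 1 / 10 * X x y ^+ 3.
have YC : correlation Y.
  by apply: correlation_comb => //; try lra; exact: correlationX.
have l0 n : (12 <= n)%N -> kernel_coef_lower R n = 0.
  by move=> n12; rewrite /kernel_coef_lower nth_default.
have := kernel_self_bound (@majority_freq_le1 R) MC YC MB (@kernel_coef_lower_le R) l0.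
have lsum : \sum_(i < 12) kernel_coef_lower R i = 7298 / 10 ^+ 4 .
  rewrite -(big_mkord xpredT (kernel_coef_lower R)) /index_iota/= !big_cons big_nil /kernel_coef_lower/=.
  lra.
rewrite lsum => /(le_trans (ler_norm _)) h.
have {h} : \sum_(i < 12) kernel_coef_lower R i * form M (fun x y => Y x y ^+ i) <=
    C + B * (745 / 1000 - 7298 / 10 ^+ 4).
  apply: le_trans h _; rewrite lerD2l ler_wpM2l// lerD2r; exact: kernel1_le.
rewrite -(big_mkord xpredT (fun i => kernel_coef_lower R i * form M (fun x y => Y x y ^+ i))).
rewrite /index_iota/= !big_cons big_nil /kernel_coef_lower/= !mul0r !add0r.
(* The coefficient of [a 1] is [9 / 10 * 1171 / 2000 = 0.52695], above [10 / 19]. The cubic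
   contributions nearly cancel, and the absolute values of all higher coefficients together with the
   neglected mass stay below [0.52695 / 20]. *)
rewrite /Y !form_binomial.
rewrite !big_ord_recr !big_ord0 /= !mulnE /=.
rewrite -!/(a _) /binomial /= /subn /addn /=.
have /andP[b1 c1] := aB 1%N.
have /andP[b3 c3] := aB 3%N. have /andP[b5 c5] := aB 5%N.
have /andP[b7 c7] := aB 7%N. have /andP[b9 c9] := aB 9%N.
have /andP[b11 c11] := aB 11%N. have /andP[b13 c13] := aB 13%N.
have /andP[b15 c15] := aB 15%N. have /andP[b17 c17] := aB 17%N.
have /andP[b19 c19] := aB 19%N. have /andP[b21 c21] := aB 21%N.
have /andP[b23 c23] := aB 23%N. have /andP[b25 c25] := aB 25%N.
have /andP[b27 c27] := aB 27%N. have /andP[b29 c29] := aB 29%N.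
have /andP[b31 c31] := aB 31%N. have /andP[b33 c33] := aB 33%N.
lra.
Qed.

(** The contraction is applied with [B] the supremum itself, finite by Cauchy-Schwarz:
    [B <= 19 / 10 * C + B / 20] solves to [B <= 2 * C]. *)
Lemma grothendieck M X (C : R) : cube_bound M C -> correlation X ->
  form M X <= 2 * C.
Proof.
move=> MC XC.
pose S := [set form M Y | Y in (@correlation R V W)].
have S1 : has_sup S.
  split; first by exists (form M X); exists X.
  exists (\sum_x \sum_y `|M x y|) => _ [Y YC <-].
  exact/form_le_norm/correlation_norm.
have SB Y : correlation Y -> form M Y <= sup S.
  by move=> YC; apply: sup_upper_bound => //; exists Y.
have SN Y : correlation Y -> `|form M Y| <= sup S.
  move=> YC; rewrite ler_norml SB// andbT lerNl -formN.
  (* Correlation matrices are closed under negation, by weights 0 and 1 in [correlation_comb]. *)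
  apply: SB; rewrite (_ : (fun _ _ => _) = fun x y => 0 * Y x y - 1 * Y x y).
    by apply: correlation_comb => //; rewrite add0r.
  by apply/funext => x; apply/funext => y; rewrite mul0r add0r mul1r.
have : sup S <= 19 / 10 * C + sup S / 20.
  apply: ge_sup; first by exists (form M X); exists X.
  by move=> _ [Y YC <-]; exact: grothendieck_contraction.
by have := SB _ XC; lra.
Qed.

End Grothendieck.

(** * Spectrum of Cayley graphs *)

Section RealSymmetric.
Variable R : realType.

Lemma char_poly_conj (F : fieldType) n (P D : 'M[F]_n) : P \in unitmx ->
  char_poly (invmx P *m D *m P) = char_poly D.
Proof.
move=> Pu; rewrite /char_poly.
have E : char_poly_mx (invmx P *m D *m P) =
    map_mx polyC (invmx P) *m char_poly_mx D *m map_mx polyC P.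
  rewrite /char_poly_mx !map_mxM mulmxBr mulmxBl; congr (_ - _).
  by rewrite mul_mx_scalar -scalemxAl -map_mxM mulVmx// map_mx1 scalemx1.
rewrite E !det_mulmx mulrAC -det_mulmx -map_mxM mulVmx// map_mx1 det1.
by rewrite mul1r.
Qed.

(** The spectral theorem over [R[i]] gives a real diagonal, and the factorisation descends because
    the embedding of polynomials is injective. *)
Lemma symmetric_char_poly n (A : 'M[R]_n) : A^T = A ->
  exists s : seq R, char_poly A = \prod_(x <- s) ('X - x%:P).
Proof.
move=> symA; pose iota : {rmorphism R -> R[i]} := real_complex R.
pose B := map_mx iota A.
have Bsym : B \is symmetricmx.
  by apply/is_hermitianmxP; rewrite expr0 scale1r map_mx_id//; apply/matrixP => i j;
     rewrite !mxE -{1}symA mxE.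
have Breal : B \is a mxOver Num.real.
  by apply/mxOverP => i j; rewrite mxE; apply/complex_realP; exists (A i j).
have Bherm := realsym_hermsym Bsym Breal.
have /orthomx_spectralP BE := hermitian_normalmx Bherm.
have /mxOverP Dreal := hermitian_spectral_diag_real Bherm.
set D := spectral_diag B in BE Dreal *.
exists [seq complex.Re (D 0 i) | i <- enum 'I_n].
apply: (map_poly_inj iota); rewrite map_char_poly -/B BE char_poly_conj ?spectral_unit//.
rewrite char_poly_trig ?diag_mx_is_trig// rmorph_prod big_map big_enum.
apply: eq_bigr => i _; rewrite rmorphB/= map_polyX map_polyC/= mxE eqxx mulr1n.
by rewrite RRe_real.
Qed.

(** The matrix determinant lemma, multiplied by [a] to avoid dividing by it. Both sides are
    [\det N * a]: one by block factorisation of [N], the other by clearing its lower left block. *)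
Lemma det_scalar_rank1 (A : comUnitRingType) n (a : A) (v : 'cV[A]_n) (u : 'rV[A]_n) :
  a * \det (a%:M + v *m u) = a ^+ n * (a + (u *m v) 0 0).
Proof.
pose N : 'M[A]_(1 + n) := block_mx 1%:M (- u) v a%:M.
have d1 : \det N = \det (a%:M + v *m u).
  have -> : N = block_mx 1%:M 0 v 1%:M *m block_mx 1%:M (- u) 0 (a%:M + v *m u).
    rewrite mulmx_block !mul1mx !mulmx0 !mul0mx !mulmx1 !addr0.
    by rewrite mulmxN addrC addrK.
  by rewrite det_mulmx det_lblock det_ublock !det1 !mul1r.
have d2 : \det N * a = a ^+ n * (a + (u *m v) 0 0).
  have da : \det (block_mx a%:M 0 (- v) 1%:M : 'M_(1 + n)) = a.
    by rewrite det_lblock det_scalar1 det1 mulr1.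
  have -> : \det N * a = \det (block_mx (a%:M + u *m v) (- u) 0 a%:M : 'M_(1 + n)).
    transitivity (\det N * \det (block_mx a%:M 0 (- v) 1%:M : 'M_(1 + n))).
      by rewrite da.
    rewrite -det_mulmx; congr determinant.
    rewrite /N mulmx_block !mul1mx !mulmx0 !mulmx1 !add0r.
    by rewrite mulmxN mulNmx opprK mul_mx_scalar mul_scalar_mx scalerN subrr.
  rewrite det_ublock det_scalar mulrC [X in \det X]mx11_scalar det_scalar1.
  by rewrite !mxE eqxx mulr1n.
by rewrite -d1 mulrC.
Qed.

Lemma det_scalar_addJ (A : comUnitRingType) n (a c : A) :
  a * \det (a%:M + c *: const_mx 1 : 'M[A]_n) = a ^+ n * (a + c * n%:R).
Proof.
have := det_scalar_rank1 a (const_mx c : 'cV_n) (const_mx 1 : 'rV_n).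
rewrite (_ : _ *m _ = c *: const_mx 1); last first.
  by apply/matrixP => i j; rewrite !mxE big_ord1 !mxE.
move=> ->; congr (_ * (_ + _)).
rewrite mxE (eq_bigr (fun=> c)) ?sumr_const ?card_ord ?mulr_natr// => k _.
by rewrite !mxE mul1r.
Qed.

(* Compare determinants in [(X - A) ((X - d) I + c J) = (X - d) (X - (A - c J))]. *)
Lemma char_poly_deflate (F : fieldType) n (A : 'M[F]_n) (c d : F) :
  c * n%:R = d -> A *m const_mx 1 = d *: const_mx 1 :> 'M_n ->
  char_poly A * 'X = char_poly (A - c *: const_mx 1) * ('X - d%:P).
Proof.
move=> cn AJ.
pose J : 'M[{poly F}]_n := const_mx 1.
have JE : map_mx polyC (const_mx 1 : 'M[F]_n) = J by apply/matrixP => i j; rewrite !mxE.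
pose Y := 'X - d%:P : {poly F}.
have AJ' : char_poly_mx A *m J = Y *: J.
  by rewrite /char_poly_mx mulmxBl mul_scalar_mx -JE -map_mxM AJ map_mxZ -scalerBl.
have E : char_poly_mx A *m (Y%:M + c%:P *: J) = Y *: char_poly_mx (A - c *: const_mx 1).
  rewrite mulmxDr mul_mx_scalar -scalemxAr AJ' scalerA mulrC -scalerA -scalerDr.
  congr (_ *: _); rewrite /char_poly_mx map_mxB map_mxZ JE opprB.
  by rewrite addrA [_ - _ + _]addrAC addrC addrA [_ + 'X%:M]addrC.
have := congr1 determinant E; rewrite det_mulmx detZ => /(congr1 ( *%R Y)).
rewrite mulrCA det_scalar_addJ.
have -> : Y + c%:P * n%:R = 'X by rewrite -polyC_natr -polyCM cn subrK.
rewrite mulrA [_ * Y ^+ n]mulrC -mulrA => h.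
have Y0 : Y != 0 by rewrite polyXsubC_eq0.
have Yn0 : Y ^+ n != 0 by rewrite expf_neq0.
by apply: (mulfI Yn0); rewrite h mulrC -!mulrA.
Qed.

End RealSymmetric.

(** * From cuts to the cube *)

Section CutNorm.
Variables (R : realType) (V W : finType) (M : V -> W -> R).
Hypothesis row0 : forall x, \sum_y M x y = 0.
Hypothesis col0 : forall y, \sum_x M x y = 0.

(** Zero row and column sums kill every term that lacks one of the two indicators. *)
Lemma form_signs (A : {set V}) (B : {set W}) :
  form M (fun x y => (2 * (x \in A)%:R - 1) * (2 * (y \in B)%:R - 1)) =
  4 * \sum_(x in A) \sum_(y in B) M x y.
Proof.
have E x y : M x y * ((2 * (x \in A)%:R - 1) * (2 * (y \in B)%:R - 1)) =
    4 * ((x \in A)%:R * (M x y * (y \in B)%:R)) - 2 * (x \in A)%:R * M x y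
    - (2 * (M x y * (y \in B)%:R) - M x y) by ring.
rewrite /form (eq_bigr (fun x => 4 * ((x \in A)%:R * \sum_(y in B) M x y)
   - \sum_y (2 * (M x y * (y \in B)%:R)))).
  rewrite sumrB [X in _ - X]exchange_big/= [X in _ - X]big1 ?subr0.
    by rewrite -mulr_sumr [in RHS]big_mkcond/=; congr (_ * _); apply: eq_bigr => x _;
       case: (x \in A); rewrite ?mul1r ?mul0r.
  by move=> y _; rewrite -mulr_sumr -mulr_suml col0 mul0r mulr0.
move=> x _; under eq_bigr do rewrite E.
rewrite !sumrB -!mulr_sumr row0 mulr0 !subr0; congr (4 * (_ * _) - _).
rewrite [in RHS]big_mkcond/=; apply: eq_bigr => y _.
by case: (y \in B); rewrite ?mulr1 ?mulr0.
Qed.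

(** The form is linear in [f] and in [g] separately, so replacing first [f] and then [g] by a sign
    vector does not decrease it; [form_signs] then applies. *)
Lemma cut_cube_bound (K : R) :
  (forall (A : {set V}) (B : {set W}), `|\sum_(x in A) \sum_(y in B) M x y| <= K) ->
  cube_bound M (4 * K).
Proof.
move=> MK f g f1 g1.
pose sgn (I : finType) (L : I -> R) := [set i | 0 <= L i].
have sgnP (I : finType) (L h : I -> R) : (forall i, `|h i| <= 1) ->
    `|\sum_i h i * L i| <= \sum_i (2 * (i \in sgn I L)%:R - 1) * L i.
  move=> h1; apply: le_trans (ler_norm_sum _ _ _) _; apply: ler_sum => i _.
  rewrite normrM; apply: (@le_trans _ _ `|L i|); first by rewrite ler_piMl.
  rewrite inE; have [L0|L0] := leP 0 (L i).
    by rewrite ger0_norm//=; lra.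
  by rewrite ltr0_norm//=; lra.
pose L x := \sum_y M x y * g y.
pose s x : R := 2 * (x \in sgn V L)%:R - 1.
pose L' y := \sum_x s x * M x y.
have -> : form M (fun x y => f x * g y) = \sum_x f x * L x.
  rewrite /form; apply: eq_bigr => x _; rewrite mulr_sumr.
  by apply: eq_bigr => y _; ring.
apply: le_trans (sgnP _ _ _ f1) _.
have -> : \sum_x s x * L x = \sum_y g y * L' y.
  under eq_bigr do rewrite mulr_sumr.
  rewrite exchange_big; apply: eq_bigr => y _; rewrite mulr_sumr.
  by apply: eq_bigr => x _; ring.
apply: le_trans (ler_norm _) _; apply: le_trans (sgnP _ _ _ g1) _.
have -> : \sum_y (2 * (y \in sgn W L')%:R - 1) * L' y =
    form M (fun x y => (2 * (x \in sgn V L)%:R - 1) * (2 * (y \in sgn W L')%:R - 1)).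
  rewrite /form [RHS]exchange_big; apply: eq_bigr => y _; rewrite mulr_sumr.
  by apply: eq_bigr => x _; rewrite /s; ring.
by rewrite form_signs ler_wpM2l//; apply: le_trans (ler_norm _) (MK _ _).
Qed.

End CutNorm.

(** * Eigenvalues of right-invariant matrices *)

Section TranslationInvariant.
Variables (R : realType) (gT : finGroupType) (M : gT -> gT -> R).
Hypothesis M_inv : forall x y g, M (x * g)%g (y * g)%g = M x y.

Lemma invariant_eigenvalue_le (C mu : R) (f : gT -> R) :
  cube_bound M C -> (exists x, f x != 0) ->
  (forall x, \sum_y M x y * f y = mu * f x) -> #|gT|%:R * `|mu| <= 2 * C.
Proof.
move=> MC [x0 fx0] fE.
pose N := \sum_x f x ^+ 2.
have N0 : 0 < N.
  rewrite /N (bigD1 x0)//= ltr_pwDl ?exprn_even_gt0//.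
  by apply: sumr_ge0 => x _; exact: sqr_ge0.
have sN : Num.sqrt N ^+ 2 = N by rewrite sqr_sqrtr ?ltW.
have trN x : \sum_g f (x * g)%g ^+ 2 = N.
  by rewrite /N [RHS](reindex_inj (mulgI x)).
(* The sign [e] is put into one family of vectors to reach both [mu] and [- mu]. *)
have C_e (e : R) : e ^+ 2 = 1 -> #|gT|%:R * (e * mu) <= 2 * C.
  move=> e1.
  pose X x y := \sum_g (f (x * g)%g / Num.sqrt N) * (e * f (y * g)%g / Num.sqrt N).
  have XC : correlation X.
    exists gT, (fun x g => f (x * g)%g / Num.sqrt N),
      (fun y g => e * f (y * g)%g / Num.sqrt N); split=> // x.
      under eq_bigr do rewrite expr_div_n sN.
      by rewrite -mulr_suml trN divff ?gt_eqF.
    under eq_bigr do rewrite expr_div_n sN exprMn e1 mul1r.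
    by rewrite -mulr_suml trN divff ?gt_eqF.
  apply: le_trans (grothendieck MC XC); rewrite le_eqVlt; apply/orP; left; apply/eqP.
  have -> : form M X = \sum_g \sum_x \sum_y
      e / N * (f (x * g)%g * (M (x * g)%g (y * g)%g * f (y * g)%g)).
    rewrite /form; under eq_bigr do under eq_bigr do rewrite mulr_sumr.
    under eq_bigr do rewrite exchange_big.
    rewrite exchange_big; apply: eq_bigr => g _; apply: eq_bigr => x _.
    apply: eq_bigr => y _; rewrite M_inv -[in e / N]sN; field.
    by rewrite sqrtr_eq0 -ltNge.
  (* Substituting along right translation by [g], every [g] contributes the same Rayleigh quotient,
     times [e]. *)
  rewrite (eq_bigr (fun=> e * mu)); first by rewrite sumr_const mulr_natl.
  move=> g _.
  have -> : \sum_x \sum_y e / N * (f (x * g)%g * (M (x * g)%g (y * g)%g * f (y * g)%g)) =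
     \sum_x e / N * (f (x * g)%g * \sum_y M (x * g)%g y * f y).
    apply: eq_bigr => x _; rewrite [in RHS](reindex_inj (mulIg g)).
    by rewrite !mulr_sumr.
  rewrite -(reindex_inj (mulIg g) (P := xpredT) (F := fun x => e / N * (f x * \sum_y M x y * f y))).
  rewrite (eq_bigr (fun x => e / N * mu * f x ^+ 2)).
    by rewrite -mulr_sumr -/N; field; rewrite gt_eqF.
  by move=> x _; rewrite fE; ring.
have [mu0|mu0] := leP 0 mu.
  by rewrite ger0_norm// -[mu]mul1r; apply: C_e; rewrite expr1n.
by rewrite ltr0_norm// -mulN1r; apply: C_e; rewrite sqrrN expr1n.
Qed.

End TranslationInvariant.

(** * The Cayley graph and its deviation from the mean density *)

Section Cayley.
Variables (R : realType) (gT : finGroupType) (S : {set gT}).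
Hypothesis symS : S = (S^-1)%g.

Lemma cayE x y : cay S x y = ((x * y^-1)%g \in S).
Proof.
apply/existsP/idP => [[s /andP[sS /eqP ->]]|xyS]; first by rewrite mulgK.
by exists (x * y^-1)%g; rewrite xyS/= mulgKV.
Qed.

Lemma cay_sym : symmetric (cay S).
Proof. by move=> x y; rewrite !cayE {1}symS mem_invg invMg invgK. Qed.

Lemma card_cay x : #|[set y | cay S x y]| = #|S|.
Proof.
rewrite -[RHS](card_imset _ (can_inj (fun s => mulgK x s))).
apply: eq_card => y; rewrite inE cay_sym cayE; apply/idP/imsetP => [h|[s sS ->]].
  by exists (y * x^-1)%g; rewrite ?mulgKV.
by rewrite mulgK.
Qed.

Lemma cay_regular : regular_graph (cay S) #|S|.
Proof. by split; [exact: cay_sym|exact: card_cay]. Qed.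

Definition cay_dev (x y : gT) : R := (cay S x y)%:R - #|S|%:R / #|gT|%:R.

Lemma cardG_neq0 : #|gT|%:R != 0 :> R.
Proof. by rewrite pnatr_eq0 -lt0n; apply/card_gt0P; exists 1%g. Qed.

Lemma cay_row_sum x : \sum_y (cay S x y)%:R = #|S|%:R :> R.
Proof.
rewrite -natr_sum -(card_cay x) -sum1_card [in RHS]big_mkcond/=; congr (_%:R).
by apply: eq_bigr => y _; rewrite inE; case: cay.
Qed.

Lemma cay_dev_row x : \sum_y cay_dev x y = 0.
Proof.
rewrite sumrB cay_row_sum sumr_const -[X in _ - X]mulr_natr mulfVK ?cardG_neq0//.
by rewrite subrr.
Qed.

Lemma cay_dev_sym x y : cay_dev x y = cay_dev y x.
Proof. by rewrite /cay_dev cay_sym. Qed.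

Lemma cay_dev_inv x y g : cay_dev (x * g)%g (y * g)%g = cay_dev x y.
Proof. by rewrite /cay_dev !cayE invMg mulgA mulgK. Qed.

Lemma sum_cay_dev (A B : {set gT}) : \sum_(x in A) \sum_(y in B) cay_dev x y =
  (edge_count (cay S) A B)%:R - #|S|%:R / #|gT|%:R * #|A|%:R * #|B|%:R.
Proof.
under eq_bigr do rewrite sumrB sumr_const.
rewrite sumrB sumr_const -[X in _ - X]mulr_natr -[X in _ - X * _]mulr_natr mulrAC.
congr (_ - _).
rewrite /edge_count -sum1_card natr_sum pair_big/= big_mkcond [RHS]big_mkcond/=.
apply: eq_bigr => p _; rewrite !inE.
by case: (p.1 \in A); case: (p.2 \in B); case: cay.
Qed.

Lemma cay_dev_cube_bound (eps : R) : uniform_graph (cay S) #|S| eps ->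
  cube_bound cay_dev (4 * (eps * #|S|%:R * #|gT|%:R)).
Proof.
move=> unif; apply: cut_cube_bound.
- exact: cay_dev_row.
- by move=> y; under eq_bigr do rewrite cay_dev_sym; exact: cay_dev_row.
- by move=> A B; rewrite sum_cay_dev; exact: unif.
Qed.

End Cayley.

(** * Eigenvalues of the adjacency matrix *)

Section Spectrum.
Variables (R : realType) (gT : finGroupType) (S : {set gT}).
Hypothesis symS : S = (S^-1)%g.
Local Notation Adj := (adjacency R (cay S)).
Local Notation d := (#|S|%:R : R).
Local Notation n := (#|gT|%:R : R).

Lemma sum_enum_rank (F : 'I_#|gT| -> R) : \sum_i F i = \sum_x F (enum_rank x).
Proof. by rewrite (reindex enum_rank)//; apply/onW_bij/enum_rank_bij. Qed.

Lemma adjacency_tr : Adj^T = Adj.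
Proof. by apply/matrixP => i j; rewrite !mxE cay_sym. Qed.

Lemma adjacency_row_sum i : \sum_j Adj i j = d.
Proof.
rewrite sum_enum_rank -(cay_row_sum R symS (enum_val i)).
by apply: eq_bigr => x _; rewrite mxE enum_rankK.
Qed.

Lemma adjacency_const m : Adj *m const_mx 1 = d *: const_mx 1 :> 'M_(_, m).
Proof.
apply/matrixP => i j; rewrite !mxE mulr1 -(adjacency_row_sum i).
by apply: eq_bigr => k _; rewrite [const_mx _ _ _]mxE mulr1.
Qed.

Lemma root_adjacency : root (char_poly Adj) d.
Proof.
rewrite -eigenvalue_root_char; apply/eigenvalueP; exists (const_mx 1).
  apply: (can_inj (@trmxK _ _ _)).
  by rewrite trmx_mul adjacency_tr trmx_const adjacency_const linearZ/= trmx_const.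
have i0 : 'I_#|gT| := enum_rank 1%g.
by apply/eqP => /rowP /(_ i0); rewrite !mxE => /eqP; rewrite oner_eq0.
Qed.

(** Compare l1 norms in the eigenvector equation: the entries are nonnegative and every row sums to
    [d]. *)
Lemma root_adjacency_le x : root (char_poly Adj) x -> x <= d.
Proof.
rewrite -eigenvalue_root_char => /eigenvalueP[v vE v0].
have Npos : 0 < \sum_j `|v 0 j|.
  rewrite lt_neqAle sumr_ge0// andbT eq_sym; apply: contra_neq v0.
  move/eqP; rewrite psumr_eq0// => /allP h; apply/rowP => j.
  by rewrite mxE; apply/eqP; rewrite -normr_eq0; apply: h; rewrite mem_index_enum.
rewrite -(ler_pM2r Npos) mulr_sumr.
apply: (@le_trans _ _ (\sum_j \sum_i `|v 0 i| * Adj i j)).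
  apply: ler_sum => j _.
  apply: (@le_trans _ _ `|x * v 0 j|).
    by rewrite normrM ler_wpM2r// ler_norm.
  have -> : x * v 0 j = \sum_i v 0 i * Adj i j by have /rowP/(_ j) := vE; rewrite !mxE => ->.
  apply: le_trans (ler_norm_sum _ _ _) _; apply: ler_sum => i _.
  by rewrite normrM [X in _ * X]ger0_norm// mxE.
rewrite exchange_big mulr_sumr; apply: ler_sum => i _.
by rewrite -mulr_sumr adjacency_row_sum mulrC.
Qed.

(** The factor 8 is 4 from cuts to the cube times 2 from Grothendieck. By symmetry the row
    eigenvector also serves as a column eigenvector. *)
Lemma root_deviation_le (eps x : R) : uniform_graph (cay S) #|S| eps ->
  root (char_poly (Adj - (d / n) *: const_mx 1)) x -> `|x| <= 8 * eps * d.
Proof.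
move=> /(cay_dev_cube_bound symS) cb.
rewrite -eigenvalue_root_char => /eigenvalueP[v vE v0].
have /(invariant_eigenvalue_le (@cay_dev_inv R gT S) cb) :
    exists g, v 0 (enum_rank g) != 0.
  apply/existsP; apply: contraNT v0; rewrite negb_exists => /forallP h.
  apply/eqP/rowP => i; rewrite mxE; apply/eqP.
  by have := h (enum_val i); rewrite negbK enum_valK.
move=> /(_ x) H.
have n0 : 0 < n by rewrite lt_neqAle eq_sym cardG_neq0/=.
rewrite -(ler_pM2l n0); apply: (le_trans (H _)); last by rewrite le_eqVlt; apply/orP; left; apply/eqP; ring.
move=> g; have /rowP/(_ (enum_rank g)) := vE.
rewrite !mxE sum_enum_rank => <-; apply: eq_bigr => h _.
by rewrite !mxE !enum_rankK (cay_dev_sym R symS) mulrC mulr1.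
Qed.

End Spectrum.

Theorem theorem1p4 (R : realType) (gT : finGroupType) (S : {set gT})
    (symS : S = (S^-1)%g) (eps : R) (eps_ge0 : 0 <= eps) :
  uniform_graph (cay S) #|S| eps ->
  exists2 lambda : R,
    lambda <= 8 * eps * #|S|%:R & ndlambda_graph (cay S) #|gT| #|S| lambda.
Proof.
move=> unif; exists (8 * eps * #|S|%:R) => //; split=> //.
  exact: cay_regular.
have [t tE] := symmetric_char_poly (adjacency_tr R symS).
pose s := sort >=%R t.
have sE : char_poly (adjacency R (cay S)) = \prod_(x <- s) ('X - x%:P).
  by rewrite tE; apply/perm_big; rewrite perm_sym perm_sort.
have s_sorted : sorted >=%R s by apply: sort_sorted => x y; exact: le_total.
exists s => // x.
have ds : #|S|%:R \in s by rewrite -root_prod_XsubC -sE root_adjacency.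
have sd y : y \in s -> y <= #|S|%:R.
  by rewrite -root_prod_XsubC -sE; exact: root_adjacency_le.
case: s sE s_sorted ds sd => [//|h r] sE hr ds sd /= xr.
(* The degree is a root and no root exceeds it, so it heads the sorted list. *)
have hd : h = #|S|%:R.
  apply/le_anti; rewrite sd ?mem_head//=.
  move: ds; rewrite inE => /predU1P[->//|dr].
  have ge_trans : transitive (>=%R : rel R) by move=> a b c ba cb; exact: le_trans cb ba.
  by have /allP/(_ _ dr) := order_path_min ge_trans hr.
apply: (root_deviation_le symS unif).
have cn : #|S|%:R / #|gT|%:R * #|gT|%:R = #|S|%:R :> R by rewrite mulfVK ?cardG_neq0.
(* Cancelling a single factor ['X - d] leaves [char_poly (A - (d / n) J)] equal to ['X] times the
   product over the tail [r], so every entry of [r], even another copy of [d], is a root of it. *)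
have := char_poly_deflate cn (adjacency_const R symS _).
rewrite sE big_cons hd -mulrA [RHS]mulrC => /mulfI h'.
by rewrite -h' ?polyXsubC_eq0// rootM root_prod_XsubC xr.
Qed.
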